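(* Let $x,\rho,\sigma$ be complex numbers (or indeterminates), and let $(a_{i,j})_{i,j\ge0}$ be the sequence defined by the recurrence $$a_{i,j}=a_{i-1,j}+a_{i,j-1}+x\,a_{i-1,j-1},\qquad i,j\ge1,$$ together with the initial conditions $a_{i,0}=\rho^i$ and $a_{0,i}=\sigma^i$ for all $i\ge0$. Then for every integer $n\ge1$, $$\det_{0\le i,j\le n-1}(a_{i,j})=(1+x)^{\binom{n-1}{2}}\,(x+\rho+\sigma-\rho\sigma)^{n-1}.$$ *)

(* Defs.v *)
From HB Require Import structures.
From mathcomp Require Export all_boot all_order all_algebra.

Set Implicit Arguments.
Unset Strict Implicit.
Unset Printing Implicit Defensive.

(* Main.v *)
(** Subtracting [rho] times the previous row from each row, and then [sigma]
    times the previous column from each column, clears the first row and column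
    except for the corner.  These operations commute with the recurrence, and the
    remaining minor satisfies it again with constant first row and column, equal
    to the corner times [x + rho + sigma - rho * sigma].  Induction therefore goes
    through once the initial values are allowed a common factor [k], all steps
    after the first one having [rho = sigma = 1]. *)
Require Import Defs.
From mathcomp Require Import all_boot all_order all_algebra.
From mathcomp Require Import ring.
Import GRing.Theory.
Local Open Scope ring_scope.

Definition row_diff {R : comNzRingType} (r : R) (f : nat -> nat -> R) (i j : nat) : R :=
  if i is i'.+1 then f i'.+1 j - r * f i' j else f 0%N j.

(** The row operation is left multiplication by a lower bidiagonal matrix [L] with unit diagonal and
    [- r] just below it, so [\det L = 1]. *)
Lemma det_row_diff {R : comNzRingType} (r : R) (f : nat -> nat -> R) (n : nat) :
  \det (\matrix_(i < n, j < n) row_diff r f i j) =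
  \det (\matrix_(i < n, j < n) f i j).
Proof.
pose L : 'M[R]_n := \matrix_(i, j) ((i == j)%:R - r *+ (i == j.+1 :> nat)).
have detL : \det L = 1.
  rewrite det_trig; last first.
    apply/is_trig_mxP => i j ltij; rewrite mxE.
    by rewrite -val_eqE /= !ltn_eqF ?subr0 // ltnS ltnW.
  by rewrite big1 // => i _; rewrite mxE eqxx ltn_eqF // subr0.
rewrite -[RHS]mul1r -detL -det_mulmx; congr (\det _).
apply/matrixP => i j; rewrite !mxE.
under eq_bigr => k _ do rewrite !mxE mulrBl.
rewrite sumrB (bigD1 i) //= eqxx mul1r big1 ?addr0; last first.
  by move=> k; rewrite eq_sym => /negPf ->; rewrite mul0r.
(* Only the subdiagonal part of [L] remains: row 0 has no such entry, and row [i.+1] picks out row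
   [i]. *)
case: i => [[|i] lti] /=.
  by rewrite big1 ?subr0 // => k _; rewrite mul0r.
rewrite (bigD1 (Ordinal (ltnW lti))) //= eqxx big1 ?addr0 // => k.
by rewrite -val_eqE eqSS eq_sym /= => /negPf ->; rewrite mul0r.
Qed.

Lemma det_col_diff {R : comNzRingType} (r : R) (f : nat -> nat -> R) (n : nat) :
  \det (\matrix_(i < n, j < n) row_diff r (fun j i => f i j) j i) =
  \det (\matrix_(i < n, j < n) f i j).
Proof.
rewrite -det_tr -[RHS]det_tr.
transitivity (\det (\matrix_(i < n, j < n) row_diff r (fun j i => f i j) i j)).
  by congr (\det _); apply/matrixP => i j; rewrite !mxE.
rewrite det_row_diff; congr (\det _).
by apply/matrixP => i j; rewrite !mxE.
Qed.

Lemma det_corner {R : comNzRingType} (f : nat -> nat -> R) (n : nat) :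
  (forall j, f 0%N j.+1 = 0) ->
  \det (\matrix_(i < n.+1, j < n.+1) f i j) =
  f 0%N 0%N * \det (\matrix_(i < n, j < n) f i.+1 j.+1).
Proof.
move=> f0; rewrite (expand_det_row _ ord0) big_ord_recl big1 ?addr0; last first.
  by move=> j _; rewrite mxE f0 mul0r.
rewrite mxE /cofactor expr0 mul1r; congr (_ * \det _).
by apply/matrixP => i j; rewrite !mxE.
Qed.

Lemma det_recurrence {R : comNzRingType} (x k rho sigma : R) (a : nat -> nat -> R)
    (n : nat) :
  (forall i j, a i.+1 j.+1 = a i j.+1 + a i.+1 j + x * a i j) ->
  (forall i, a i 0%N = k * rho ^+ i) ->
  (forall j, a 0%N j = k * sigma ^+ j) ->
  \det (\matrix_(i < n.+1, j < n.+1) a i j) =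
    k ^+ n.+1 * (1 + x) ^+ 'C(n, 2) * (x + rho + sigma - rho * sigma) ^+ n.
Proof.
elim: n k rho sigma a => [|n IHn] k rho sigma a a_rec a_col a_row.
  by rewrite det_mx11 mxE a_col bin0n !expr0 !mulr1.
pose b i j := row_diff sigma (fun j i => row_diff rho a i j) j i.
have b00 : b 0%N 0%N = k by rewrite /b /= a_col mulr1.
have b0S j : b 0%N j.+1 = 0 by rewrite /b /= !a_row exprS; ring.
have bSS i j : b i.+1 j.+1 =
    a i.+1 j.+1 - rho * a i j.+1 - sigma * (a i.+1 j - rho * a i j) by [].
set c := x + rho + sigma - rho * sigma.
have b_rec i j : b i.+2 j.+2 = b i.+1 j.+2 + b i.+2 j.+1 + x * b i.+1 j.+1.
  by rewrite !bSS !a_rec; ring.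
(* Column 0 is geometric of ratio [rho], so its terms cancel and [b i.+2 1 = b i.+1 1]. The factor
   [1 ^+ i] gives the shape that [IHn] expects. *)
have b_col i : b i.+1 1%N = k * c * 1 ^+ i.
  rewrite expr1n mulr1; elim: i => [|i IHi].
    by rewrite bSS a_rec !a_col a_row /c; ring.
  by rewrite -IHi !bSS !(a_rec _ 0%N) !a_col !exprS; ring.
have b_row j : b 1%N j.+1 = k * c * 1 ^+ j.
  rewrite expr1n mulr1; elim: j => [|j IHj].
    by rewrite bSS a_rec !a_col a_row /c; ring.
  by rewrite -IHj !bSS !(a_rec 0%N) !a_row !exprS; ring.
rewrite -(det_row_diff rho) -(det_col_diff sigma) (det_corner b) // b00.
rewrite (IHn (k * c) 1 1 (fun i j => b i.+1 j.+1)) //.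
(* The smaller minor thus contributes [n] further factors [1 + x], matching
   ['C(n.+1, 2) = 'C(n, 2) + n]. *)
have -> : x + 1 + 1 - 1 * 1 = 1 + x by ring.
by rewrite binS bin1 exprD exprMn [k ^+ n.+2]exprS; ring.
Qed.

Theorem theorem1 (R : comNzRingType) (x rho sigma : R) (a : nat -> nat -> R)
  (a_rec : forall i j : nat, (1 <= i)%N -> (1 <= j)%N ->
     a i j = a (i - 1)%N j + a i (j - 1)%N + x * a (i - 1)%N (j - 1)%N)
  (a_col0 : forall i : nat, a i 0%N = rho ^+ i)
  (a_row0 : forall i : nat, a 0%N i = sigma ^+ i)
  (n : nat) (n_ge1 : (1 <= n)%N) :
  \det (\matrix_(i < n, j < n) a i j) =
    (1 + x) ^+ 'C(n - 1, 2) * (x + rho + sigma - rho * sigma) ^+ (n - 1).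
Proof.
case: n n_ge1 => // n _; rewrite subn1 /=.
rewrite (det_recurrence x 1 rho sigma) ?expr1n ?mul1r // => [i j|i|j].
- by rewrite a_rec // !subn1.
- by rewrite mul1r.
- by rewrite mul1r.
Qed.
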